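(* Let $M$ be an $m\times n$ totally unimodular matrix with columns $\bm{a}_1,\ldots,\bm{a}_n$ and let $\bm{k}\in\mathbb{Z}_{\ge0}^n$. Then the Laurent polynomial \[ P_{M,\bm{k}}(x_1,\ldots,x_m)=\prod_{j=1}^n\left(\sum_{\ell=0}^{k_j}\bm{x}^{\ell\bm{a}_j}\right) \] belongs to $\operatorname{VLC}_m$.
   Context: A matrix is totally unimodular if all of its minors lie in $\{-1,0,1\}$. $\bm{x}^{\bm{a}}=\prod_i x_i^{a_i}$. A sequence $\{a_k\}_{k\in\mathbb{Z}}$ of nonnegative reals is log-concave if it has no internal zeros and $a_k^2\ge a_{k-1}a_{k+1}$ for all $k$. The class $\operatorname{VLC}_n$ of real Laurent polynomials is defined recursively: $\operatorname{VLC}_1$ is the set of univariate Laurent polynomials $\sum_k p_kx^k$ (finite support) whose coefficient sequence $\{p_k\}_{k\in\mathbb{Z}}$ is log-concave; for $n\ge2$, $\operatorname{VLC}_n$ is the set of Laurent polynomials $p$ in $n$ variables with nonnegative coefficients such that (i) evaluating any $n-1$ of the variables of $p$ at positive reals gives an element of $\operatorname{VLC}_1$, and (ii) $[x_i^{\alpha_i}]p\in\operatorname{VLC}_{n-1}$ for all $i\in[n]$ and $\alpha_i\in\mathbb{Z}$, where $[x_i^{\alpha_i}]p$ is the coefficient of $x_i^{\alpha_i}$ in $p$, viewed as a Laurent polynomial in the remaining $n-1$ variables. *)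

(* Defs.v *)
From HB Require Import structures.
From mathcomp Require Import all_boot all_order all_algebra.
From mathcomp Require Import finmap.
From mathcomp Require Import reals.
From mathcomp Require Import monalg.
Set Implicit Arguments.
Unset Strict Implicit.
Unset Printing Implicit Defensive.
Import Order.TTheory GRing.Theory Num.Theory.
Local Open Scope ring_scope.

Definition totally_unimodular m n (M : 'M[int]_(m, n)) : Prop :=
  forall (r : nat) (f : 'I_r -> 'I_m) (g : 'I_r -> 'I_n),
    {homo f : i j / (i < j)%N} -> {homo g : i j / (i < j)%N} ->
    \det (mxsub f g M) \in [:: -1; 0; 1].

(* A Laurent polynomial is a finitely supported family of coefficients indexed
   by exponent vectors in Z^n.  The ring structure of {malg R[K]} requires a
   monoid K without nontrivial units, so the convolution product is set up
   here, on top of the module structure of {malg R[K]}. *)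
Definition laurent (R : realType) (n : nat) : Type := {malg R['rV[int]_n]}.

Section LaurentRing.
Variables (R : realType) (n : nat).
Implicit Types (p q s : laurent R n) (a b : 'rV[int]_n).

HB.instance Definition _ := GRing.Lmodule.on (laurent R n).

Definition lmonom a : laurent R n := << 1 *g a >>.

Definition lmul p q : laurent R n :=
  \sum_(a <- msupp p) \sum_(b <- msupp q) << p@_a * q@_b *g (a + b)%R >>.

Lemma lsum_ext (V : zmodType) (F : 'rV[int]_n -> R -> V) p (d : {fset 'rV[int]_n}) :
  (forall a, F a 0 = 0) -> (msupp p `<=` d)%fset ->
  \sum_(a <- msupp p) F a p@_a = \sum_(a <- d) F a p@_a.
Proof.
move=> F0 sd; apply: (big_fset_incl _ sd) => a _ /mcoeff_outdom ->; exact: F0.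
Qed.

Lemma lmulE p q (d e : {fset 'rV[int]_n}) :
  (msupp p `<=` d)%fset -> (msupp q `<=` e)%fset ->
  lmul p q = \sum_(a <- d) \sum_(b <- e) << p@_a * q@_b *g (a + b)%R >>.
Proof.
move=> sd se; rewrite /lmul.
rewrite (lsum_ext (F := fun a x =>
  \sum_(b <- msupp q) << x * q@_b *g (a + b)%R >>) _ sd); last first.
  by move=> a; rewrite big1 // => b _; rewrite mul0r monalgU0.
apply: eq_bigr => a _.
rewrite (lsum_ext (F := fun b x => << p@_a * x *g (a + b)%R >>) _ se) //.
by move=> b; rewrite mulr0 monalgU0.
Qed.

Lemma lmulC : commutative lmul.
Proof.
move=> p q; rewrite /lmul exchange_big /=.
by apply: eq_bigr => b _; apply: eq_bigr => a _; rewrite mulrC addrC.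
Qed.

Lemma lmulDl : left_distributive lmul +%R.
Proof.
move=> p q s; set d := (msupp p `|` msupp q)%fset.
rewrite (@lmulE (p + q) s d (msupp s)) ?msuppD_le ?fsubset_refl //.
rewrite (@lmulE p s d (msupp s)) ?fsubsetUl ?fsubset_refl //.
rewrite (@lmulE q s d (msupp s)) ?fsubsetUr ?fsubset_refl //.
rewrite -big_split; apply: eq_bigr => a _; rewrite -big_split.
by apply: eq_bigr => b _; rewrite mcoeffD mulrDl monalgUD.
Qed.

Lemma lmulDr : right_distributive lmul +%R.
Proof. by move=> p q s; rewrite lmulC lmulDl !(lmulC _ p). Qed.

Lemma lmul0l : left_zero 0 lmul.
Proof. by move=> q; rewrite /lmul msupp0 big_seq_fset0. Qed.

Lemma lmul_suml (I : Type) (r : seq I) (F : I -> laurent R n) q :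
  lmul (\sum_(i <- r) F i) q = \sum_(i <- r) lmul (F i) q.
Proof.
apply: (big_morph (lmul^~ q)); last exact: lmul0l.
by move=> p s; exact: lmulDl.
Qed.

Lemma lmul_sumr (I : Type) (r : seq I) (F : I -> laurent R n) p :
  lmul p (\sum_(i <- r) F i) = \sum_(i <- r) lmul p (F i).
Proof.
by rewrite lmulC lmul_suml; apply: eq_bigr => i _; rewrite lmulC.
Qed.

Lemma lmulUU (x y : R) a b :
  lmul << x *g a >> << y *g b >> = << x * y *g (a + b)%R >>.
Proof.
by rewrite (lmulE (msuppU_le (k := a)) (msuppU_le (k := b))) !big_seq_fset1
  !mcoeffUU.
Qed.

Lemma laurentE p : p = \sum_(a <- msupp p) (<< p@_a *g a >> : laurent R n).
Proof. exact: monalgE. Qed.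

Lemma lmulA : associative lmul.
Proof.
move=> p q s; rewrite [p]laurentE !lmul_suml; apply: eq_bigr => a _.
rewrite [q]laurentE lmul_suml !lmul_sumr lmul_suml; apply: eq_bigr => b _.
rewrite [s]laurentE !lmul_sumr; apply: eq_bigr => c _.
by rewrite !lmulUU mulrA addrA.
Qed.

Lemma lmul1l : left_id (lmonom 0) lmul.
Proof.
move=> p; rewrite [p in LHS]laurentE lmul_sumr [RHS]laurentE.
by apply: eq_bigr => a _; rewrite lmulUU mul1r add0r.
Qed.

Lemma lmonom_neq0 a : lmonom a != 0.
Proof. by rewrite /lmonom monalgU_eq0 oner_eq0. Qed.

HB.instance Definition _ := GRing.Zmodule_isComNzRing.Build (laurent R n)
  lmulA lmulC lmul1l lmulDl (lmonom_neq0 0).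

End LaurentRing.

Definition lcoef (R : realType) n (i : 'I_n.+1) (alpha : int)
    (p : laurent R n.+1) : laurent R n :=
  \sum_(a <- msupp p | a 0 i == alpha) (<< p@_a *g col' i a >> : laurent R n).

(* All variables but the i-th are evaluated; the value x i is not used. *)
Definition leval_but (R : realType) n (i : 'I_n) (x : 'I_n -> R)
    (p : laurent R n) : laurent R 1 :=
  \sum_(a <- msupp p)
     (<< p@_a * (\prod_(j < n | j != i) x j ^ a 0 j) *g const_mx (a 0 i) >>
      : laurent R 1).

Definition log_concave (R : realType) (c : int -> R) : Prop :=
  [/\ forall k, 0 <= c k,
      forall i j k : int, i < j -> j < k -> c i != 0 -> c k != 0 -> c j != 0
    & forall k : int, c (k - 1) * c (k + 1) <= c k ^+ 2].

Definition VLC1 (R : realType) (p : laurent R 1) : Prop :=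
  log_concave (fun k => p@_(const_mx k)).

Fixpoint VLC_succ (R : realType) (n : nat) : laurent R n.+1 -> Prop :=
  match n with
  | 0 => @VLC1 R
  | m.+1 => fun p =>
      [/\ forall a, 0 <= p@_a,
          forall (i : 'I_m.+2) (x : 'I_m.+2 -> R),
            (forall j, j != i -> 0 < x j) ->
            VLC1 (leval_but i x p)
        & forall i alpha, VLC_succ (lcoef i alpha p)]
  end.

(* The class is only defined for n >= 1; the value at n = 0 is a dummy. *)
Definition VLC (R : realType) (n : nat) : laurent R n -> Prop :=
  match n with
  | 0 => fun _ => False
  | m.+1 => @VLC_succ R m
  end.

Definition Ppoly (R : realType) m n (M : 'M[int]_(m, n)) (k : 'I_n -> nat) :
    laurent R m :=
  \prod_(j < n) \sum_(l < (k j).+1) lmonom R (l%:Z *: (col j M)^T).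

(* Main.v *)
Require Import Defs.
From mathcomp Require Import all_boot all_order all_algebra.
From mathcomp Require Import reals.
From mathcomp Require Import perm finmap monalg.
From mathcomp Require Import lra zify.
Set Implicit Arguments.
Unset Strict Implicit.
Unset Printing Implicit Defensive.
Import Order.TTheory GRing.Theory Num.Theory.
Local Open Scope ring_scope.

(** Everything reduces to lattice points of boxes [lo, hi] in Z^n: for M totally
    unimodular let X(b) be the set of integer points u of the box with M u = b.
    The key fact is that #|X(b)| <= #|X(c)| as soon as M (lo + hi) = 2c, i.e. the
    fibre through the centre of the box is the largest.  To see this, sort the
    pairs in X(b) x X(b) by their difference d: for d <> 0 in the kernel of M
    they are the points of the fibre over b of the smaller box
    [lo, hi] /\ ([lo, hi] + d), for which c is still central, so by induction
    #|X(b)|^2 - #|X(b)| <= #|X(c)|^2 - #|X(c)|; and X(c) is nonempty because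
    total unimodularity rounds the centre to an integer point.

    Sorting the pairs in X(b) x X(b') by their sum w, and applying this to the
    boxes [lo, hi] /\ (w - [lo, hi]), gives F(b) F(b') <= F(c)^2 whenever
    b + b' = 2c, where F is the sum over X of a positive multiplicative weight.
    The coefficients of all specializations of P_{M,k} are such sums F, where
    the rows of M are the extracted exponents and the remaining exponent. *)

(** * Submatrices of totally unimodular matrices *)

(** With arbitrary index maps in place of increasing ones, the property passes by composition to
    every matrix whose rows are rows of [M], repeated or reordered at will. *)
Definition unimodular m n (M : 'M[int]_(m, n)) : Prop :=
  forall (r : nat) (f : 'I_r -> 'I_m) (g : 'I_r -> 'I_n),
    \det (mxsub f g M) \in [:: -1; 0; 1].

(** Sending [i] to the rank of [f i] among the values of [f] is a permutation, and its inverse sorts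
    [f]. *)
Lemma injective_sort r m (f : 'I_r -> 'I_m) : injective f ->
  exists s : 'S_r, {homo f \o s : i j / (i < j)%N}.
Proof.
move=> f_inj.
have [rk rk_lt] : exists rk : 'I_r -> 'I_r,
    forall i j, (f i < f j)%N -> (rk i < rk j)%N.
  have rk_ltr i : (#|[pred i' | (f i' < f i)%N]| < r)%N.
    rewrite -[X in (_ < X)%N]card_ord; apply/proper_card/properP.
    by split; [exact/subsetP | exists i; rewrite // inE /= ltnn].
  exists (fun i => Ordinal (rk_ltr i)) => i j lt_ij /=.
  apply/proper_card/properP; split; last first.
    by exists i; rewrite inE //= ltnn.
  by apply/subsetP => i'; rewrite !inE => /ltn_trans; apply.
have rk_inj : injective rk.
  move=> i j rk_ij; apply/f_inj/val_inj.
  by case: (ltngtP (f i) (f j)) => // /rk_lt; rewrite rk_ij ltnn.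
exists (perm rk_inj)^-1%g => i j lt_ij /=.
have rkV i' : rk ((perm rk_inj)^-1%g i') = i'.
  by rewrite -[in RHS](permKV (perm rk_inj) i') permE.
rewrite ltnNge leq_eqVlt; apply/negP => /orP[/eqP/val_inj/f_inj/perm_inj ji | /rk_lt].
  by rewrite ji ltnn in lt_ij.
by rewrite !rkV ltnNge ltnW.
Qed.

(** A repeated row or column makes the determinant vanish; otherwise sorting rows and columns
    changes it by a sign only. *)
Lemma totally_unimodularP m n (M : 'M[int]_(m, n)) :
  totally_unimodular M -> unimodular M.
Proof.
have signs (b : bool) (x : int) :
    x \in [:: -1; 0; 1] -> (-1) ^+ b * x \in [:: -1; 0; 1].
  by rewrite !inE; case: b; rewrite ?expr0 ?expr1 => /or3P[] /eqP ->.
move=> tuM r f g.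
have [/injectiveP f_inj | /injectivePn[i [i' ne_ii' eq_f]]] := boolP (injectiveb f);
    last first.
  rewrite (determinant_alternate ne_ii') ?inE ?eqxx ?orbT // => j.
  by rewrite !mxE eq_f.
have [/injectiveP g_inj | /injectivePn[j [j' ne_jj' eq_g]]] := boolP (injectiveb g);
    last first.
  rewrite -det_tr (determinant_alternate ne_jj') ?inE ?eqxx ?orbT // => i.
  by rewrite !mxE eq_g.
have [[s homo_fs] [t homo_gt]] := (injective_sort f_inj, injective_sort g_inj).
have -> : mxsub f g M =
    row_perm s^-1%g (col_perm t^-1%g (mxsub (f \o s) (g \o t) M)).
  by apply/matrixP => i j; rewrite !mxE /= !permKV.
rewrite row_permE col_permE !det_mulmx !det_perm.
by apply: (signs (odd_perm _)); rewrite mulrC; apply/(signs (odd_perm _))/tuM.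
Qed.

Lemma unimodular_rows m m' n (M : 'M[int]_(m, n)) (N : 'M[int]_(m', n)) :
  unimodular M -> (forall i, exists i', row i N = row i' M) -> unimodular N.
Proof.
move=> uM /fin_all_exists[h hP] r f g.
have -> : mxsub f g N = mxsub (h \o f) g M; last exact: uM.
apply/matrixP => i j; rewrite !mxE /=.
by have /rowP/(_ (g j)) := hP (f i); rewrite !mxE.
Qed.

(** * Rounding rational solutions to integer ones *)

Local Notation intmx := (map_mx (intr : int -> rat)).

(** Meant for [z] in the kernel of a matrix: the image of [y] is kept while a coordinate in [J]
    becomes integral, because the bounds of the box are integers. *)
Lemma kernel_step n (J : {set 'I_n}) (lo hi : 'cV[int]_n) (y z : 'cV[rat]_n) :
    (forall j, (lo j 0)%:~R <= y j 0 <= (hi j 0)%:~R) ->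
    (forall j, j \notin J -> z j 0 = 0) -> z != 0 ->
  exists t, (forall j, (lo j 0)%:~R <= (y + t *: z) j 0 <= (hi j 0)%:~R) /\
    exists2 j, j \in J & (y + t *: z) j 0 \is a Num.int.
Proof.
move=> y_in zJ z_neq0.
have [j0 zj0] : exists j, z j 0 != 0.
  apply/existsP; apply: contraNT z_neq0 => /existsPn z0.
  by apply/eqP/colP => j; rewrite mxE; exact/eqP/negbNE/z0.
(* The distance to the face of the box that the ray from [y] along [z] meets
   first in coordinate [j]. *)
pose bd j : rat := if 0 < z j 0 then (hi j 0)%:~R else (lo j 0)%:~R.
pose T j := (bd j - y j 0) / z j 0.
have T_ge0 j : z j 0 != 0 -> 0 <= T j.
  have /andP[lo_y y_hi] := y_in j; rewrite /T /bd; case: ltgtP => // z0 _.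
    by rewrite mulr_ge0 ?subr_ge0 // invr_ge0 ltW.
  by rewrite mulr_le0 ?subr_le0 // invr_le0 ltW.
have [j1 zj1 minT] := arg_minP T (zj0 : [pred j | z j 0 != 0] j0).
have tz j : z j 0 != 0 -> y j 0 + T j * z j 0 = bd j.
  by move=> zj; rewrite /T divfK // addrC subrK.
exists (T j1); split=> [j | ]; last first.
  exists j1; first by apply: contraR zj1 => /zJ ->; rewrite eqxx.
  by rewrite !mxE tz // /bd; case: ifP => _; apply/intrP; eexists.
have /andP[lo_y y_hi] := y_in j; rewrite !mxE.
have [-> | zj] := eqVneq (z j 0) 0; first by rewrite mulr0 addr0 lo_y.
have := tz j zj; have := minT j zj; rewrite /bd.
have := T_ge0 _ zj1; case: ltgtP zj => // z0 _ T0 leT bdE.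
  rewrite -bdE lerD2l ler_pM2r // leT andbT.
  by rewrite (le_trans lo_y) // lerDl mulr_ge0 // ltW.
rewrite -bdE lerD2l ler_nM2r // leT /=.
by rewrite (le_trans _ y_hi) // gerDl mulr_ge0_le0 // ltW.
Qed.

(** An invertible [Z] has determinant 1 or -1 here, so its inverse is an integer matrix. *)
Lemma unimodular_solve r (Z : 'M[int]_r) (w : 'cV[rat]_r) (c : 'cV[int]_r) :
    \det Z \in [:: -1; 0; 1] -> intmx Z \in unitmx -> intmx Z *m w = intmx c ->
  forall i, w i 0 \is a Num.int.
Proof.
rewrite unitmxE det_map_mx unitfE intr_eq0 => detZ nzZ Zw i.
have uZ : Z \in unitmx.
  by rewrite unitmxE; move: detZ nzZ; rewrite !inE => /or3P[] /eqP->.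
have -> : w = intmx (invmx Z *m c).
  by rewrite map_mxM -Zw mulmxA -map_mxM mulVmx // map_mx1 mul1mx.
by rewrite mxE; apply/intrP; eexists.
Qed.

(** Hoffman-Kruskal integrality, by induction on the number of fractional coordinates of [y]. If the
    columns of [M] at these coordinates are independent, an invertible square submatrix forces the
    coordinates to be integers, a contradiction; otherwise a kernel vector supported there permits a
    [kernel_step]. *)
Lemma unimodular_integral m n (M : 'M[int]_(m, n)) (lo hi : 'cV[int]_n)
    (b : 'cV[int]_m) (y : 'cV[rat]_n) : unimodular M ->
    (forall j, (lo j 0)%:~R <= y j 0 <= (hi j 0)%:~R) ->
    intmx M *m y = intmx b ->
  exists2 u : 'cV[int]_n, (forall j, lo j 0 <= u j 0 <= hi j 0) & M *m u = b.
Proof.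
move=> uM; pose frac (y : 'cV[rat]_n) := [set j | y j 0 \isn't a Num.int].
have [N] := ubnP #|frac y|; elim: N => // N IHN in y *.
rewrite ltnS => le_frac y_in My.
have fracE y' j : (j \in frac y') = (y' j 0 \isn't a Num.int) by rewrite in_set.
have [frac0 | [j0 fj0]] := set_0Vmem (frac y).
  have /fin_all_exists[u yE] j : exists u : int, y j 0 = u%:~R.
    by apply/intrP; have /setP/(_ j) := frac0; rewrite fracE inE => /negbFE.
  exists (\col_j u j) => [j | ].
    by rewrite mxE; have := y_in j; rewrite yE !ler_int.
  have yu : y = intmx (\col_j u j) by apply/colP => j; rewrite !mxE yE.
  apply/matrixP => i j; apply: (@intr_inj rat).
  by have /matrixP/(_ i j) := My; rewrite yu -map_mxM !mxE.
pose g : 'I_#|frac y| -> 'I_n := enum_val.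
have gK j : j \in frac y -> exists i, j = g i.
  by move=> fj; exists (enum_rank_in fj0 j); rewrite /g enum_rankK_in.
have g_inj : injective g := enum_val_inj.
have [full | not_full] := boolP (row_full (colsub g (intmx M))).
  (* [v] is [y] with its fractional coordinates set to zero; at the others the floor is exact. *)
  pose v : 'cV[int]_n := \col_j (if j \in frac y then 0 else Num.floor (y j 0)).
  have yE : y = intmx v + colsub g 1%:M *m rowsub g y.
    apply/colP => j; rewrite !mxE.
    have [fj | nfj] := boolP (j \in frac y).
      have [i ->] := gK j fj; rewrite (bigD1 i) //= !mxE eqxx mul1r add0r.
      rewrite big1 ?addr0 // => i' ne_i'i; rewrite !mxE eq_sym (inj_eq g_inj).
      by rewrite (negPf ne_i'i) mul0r.
    rewrite big1 => [|i _]; last first.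
      rewrite !mxE; case: eqP => [jg | _]; last by rewrite mul0r.
      by rewrite jg enum_valP in nfj.
    rewrite addr0 floorK //.
    exact: negbNE (etrans (esym (congr1 negb (fracE _ _))) nfj).
  have MyJ : colsub g (intmx M) *m rowsub g y = intmx (b - M *m v).
    rewrite -[X in colsub g X]mulmx1 -mulmx_colsub -mulmxA.
    by rewrite map_mxB map_mxM -My -mulmxBr [X in _ *m (X - _)]yE addrC addKr.
  have MfE : mxsub (fullrankfun full) g (intmx M) =
      rowsub (fullrankfun full) (colsub g (intmx M)).
    by apply/matrixP => i j; rewrite !mxE.
  have Zint := @unimodular_solve _ (mxsub (fullrankfun full) g M) (rowsub g y)
    (rowsub (fullrankfun full) (b - M *m v)) (uM _ _ _).
  have /gK[i0 j0E] := fj0; move: fj0; rewrite fracE j0E; case/negP.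
  have <- : (rowsub g y) i0 0 = y (g i0) 0 by rewrite mxE.
  apply: Zint; rewrite map_mxsub MfE ?fullrowsub_unit // mul_rowsub_mx MyJ.
  by rewrite map_mxsub.
have /matrix0Pn[i0 [c0 C_neq0]] : cokermx (colsub g (intmx M)) != 0.
  by rewrite cokermx_eq0.
(* A nonzero column of the cokernel matrix is a linear relation between the fractional columns; [z]
   extends it by zero. *)
pose z0 := col c0 (cokermx (colsub g (intmx M))).
pose z := colsub g 1%:M *m z0.
have Mz : intmx M *m z = 0.
  by rewrite /z mulmxA (mulmx_colsub g) mulmx1 /z0 colE mulmxA mulmx_coker mul0mx.
have z_neq0 : z != 0.
  apply: contraNneq C_neq0 => /colP/(_ (g i0)); rewrite mxE (bigD1 i0) //=.
  rewrite big1 => [|i ne_ii0]; last first.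
    by rewrite !mxE (inj_eq g_inj) eq_sym (negPf ne_ii0) mul0r.
  by rewrite /z0 addr0 !mxE eqxx mul1r => ->.
have zJ j : j \notin frac y -> z j 0 = 0.
  move=> nfj; rewrite mxE big1 // => i _; rewrite !mxE.
  by case: eqP => [jg | _]; [rewrite jg enum_valP in nfj | rewrite mul0r].
have [t [y'_in [j1 fj1 int_j1]]] := kernel_step y_in zJ z_neq0.
apply: (IHN (y + t *: z)) => //; last first.
  by rewrite mulmxDr -scalemxAr Mz scaler0 addr0.
apply: leq_trans le_frac; apply/proper_card/properP; split.
  apply/subsetP => j; apply: contraLR => nfj; move: (nfj).
  by rewrite !fracE mxE [X in _ + X]mxE zJ // mulr0 addr0.
by exists j1; rewrite // fracE negbK.
Qed.

(** * Boxes and fibres of lattice points *)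

Definition in_box n (lo hi u : 'cV[int]_n) : bool :=
  [forall j, lo j 0 <= u j 0 <= hi j 0].

(** Offsets from [lo] are bounded by the sum of all widths, a single bound that serves every
    coordinate; the filter then cuts out the box. *)
Definition box n (lo hi : 'cV[int]_n) : {fset 'cV[int]_n} :=
  let offset (f : {ffun 'I_n -> 'I_(\sum_j `|(hi j 0 - lo j 0)%R|).+1}) :=
    (lo + \col_j (f j)%:Z)%R in
  [fset u in [fset offset f | f in predT] | in_box lo hi u]%fset.

Lemma in_boxP n (lo hi u : 'cV[int]_n) :
  reflect (forall j, lo j 0 <= u j 0 <= hi j 0) (in_box lo hi u).
Proof. exact: forallP. Qed.

Lemma mem_box n (lo hi u : 'cV[int]_n) : (u \in box lo hi) = in_box lo hi u.
Proof.
rewrite !inE /=; apply/andb_idl => /in_boxP u_in; apply/imfsetP => /=.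
exists [ffun j => inord `|(u j 0 - lo j 0)%R|] => //.
apply/colP => j; rewrite !mxE ffunE; have := u_in j => /andP[lo_u u_hi].
rewrite inordK; last first.
  by rewrite ltnS (bigD1 j) //=; lia.
by rewrite gez0_abs ?subr_ge0 // addrC subrK.
Qed.

(** Pairs are sorted by [w = kappa u v]; since [tau u] recovers [v] from [w], a pair is determined
    by [u] and [w]. Used with [kappa] the difference and the sum. *)
Lemma double_sum_reindex (V : nmodType) (G : choiceType) (kappa tau : G -> G -> G)
    (A B D : {fset G}) (h : G -> V) :
    (forall u, cancel (kappa u) (tau u)) -> (forall u, cancel (tau u) (kappa u)) ->
    (forall u v, u \in A -> v \in B -> kappa u v \in D) ->
  \sum_(u <- A) \sum_(v <- B) h (kappa u v) =
  \sum_(w <- D) h w *+ #|` [fset u in A | tau u w \in B]%fset|.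
Proof.
move=> kappaK tauK ABD.
transitivity (\sum_(u <- A) \sum_(w <- D | tau u w \in B) h w).
  rewrite !big_seq; apply: eq_bigr => u uA.
  have kappa_inj : {in B &, injective (kappa u)}.
    by move=> v v' _ _; apply: (can_inj (kappaK u)).
  rewrite [RHS]big_fset_condE -(big_imfset _ imfset_key _ kappa_inj) /=.
  apply: eq_fbigl => w; apply/imfsetP/idP => /= [[v vB ->] | ].
    by rewrite !inE /= ABD // kappaK.
  by rewrite !inE => /andP[_ wB]; exists (tau u w); rewrite ?tauK.
under eq_bigr do rewrite big_mkcond.
rewrite exchange_big /=; apply: eq_bigr => w _.
by rewrite -big_mkcond /= big_fset_condE big_const_seq count_predT iter_addr_0.
Qed.

Lemma in_fset_sep (T : choiceType) (A : {fset T}) (P : pred T) x :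
  (x \in [fset y in A | P y]%fset) = (x \in A) && P x.
Proof. by rewrite !inE. Qed.

Definition points m n (M : 'M[int]_(m, n)) (lo hi : 'cV[int]_n)
    (b : 'cV[int]_m) : {fset 'cV[int]_n} :=
  [fset u in box lo hi | M *m u == b]%fset.

Lemma mem_points m n (M : 'M[int]_(m, n)) lo hi b u :
  (u \in points M lo hi b) = in_box lo hi u && (M *m u == b).
Proof. by rewrite -mem_box !inE. Qed.

Local Notation maxmx := (map2_mx (Order.max : int -> int -> int)).
Local Notation minmx := (map2_mx (Order.min : int -> int -> int)).

Lemma itv_sub (l h x e : int) :
  (Order.max l (l + e) <= x <= Order.min h (h + e)) =
  (l <= x <= h) && (l <= x - e <= h).
Proof. by rewrite ge_max le_min lerBrDr lerBlDr andbACA. Qed.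

Lemma itv_rsub (l h x e : int) :
  (Order.max l (e - h) <= x <= Order.min h (e - l)) =
  (l <= x <= h) && (l <= e - x <= h).
Proof.
rewrite ge_max le_min andbACA; congr (_ && _).
by rewrite andbC !lerBrDr !lerBlDr (addrC l) (addrC h).
Qed.

(** Applied coordinatewise to a shift by a kernel vector, this keeps the image of [lo + hi] and
    hence the central fibre. *)
Lemma itv_sub_mid (l h e : int) :
  Order.max l (l + e) + Order.min h (h + e) = l + h + e.
Proof. lia. Qed.

Lemma itv_rsub_mid (l h e : int) :
  Order.max l (e - h) + Order.min h (e - l) = e.
Proof. lia. Qed.

Lemma in_box_sub n (lo hi u d : 'cV[int]_n) :
  in_box (maxmx lo (lo + d)) (minmx hi (hi + d)) u =
  in_box lo hi u && in_box lo hi (u - d).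
Proof.
apply/in_boxP/andP => [u_in | [/in_boxP u_in /in_boxP ud_in] j].
  by split; apply/in_boxP => j; have := u_in j; rewrite !mxE itv_sub => /andP[].
by have := ud_in j; rewrite !mxE itv_sub u_in => ->.
Qed.

Lemma in_box_rsub n (lo hi u w : 'cV[int]_n) :
  in_box (maxmx lo (w - hi)) (minmx hi (w - lo)) u =
  in_box lo hi u && in_box lo hi (w - u).
Proof.
apply/in_boxP/andP => [u_in | [/in_boxP u_in /in_boxP wu_in] j].
  by split; apply/in_boxP => j; have := u_in j; rewrite !mxE itv_rsub => /andP[].
by have := wu_in j; rewrite !mxE itv_rsub u_in => ->.
Qed.

Lemma points_sub m n (M : 'M[int]_(m, n)) lo hi b d : M *m d = 0 ->
  [fset u in points M lo hi b | u - d \in points M lo hi b]%fset =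
  points M (maxmx lo (lo + d)) (minmx hi (hi + d)) b.
Proof.
move=> Md; apply/fsetP => u.
by rewrite in_fset_sep !mem_points mulmxBr Md subr0 andbACA andbb in_box_sub.
Qed.

(** For [u] over [b], the point [w - u] lies over [b'] automatically, so only the box condition
    remains. *)
Lemma points_rsub m n (M : 'M[int]_(m, n)) lo hi b b' w : M *m w = b + b' ->
  [fset u in points M lo hi b | w - u \in points M lo hi b']%fset =
  points M (maxmx lo (w - hi)) (minmx hi (w - lo)) b.
Proof.
move=> Mw; apply/fsetP => u; rewrite in_fset_sep !mem_points in_box_rsub.
rewrite mulmxBr Mw andbACA; have [-> | _] := eqVneq (M *m u) b.
  by rewrite addrAC subrr add0r eqxx andbT.
by rewrite andbF.
Qed.

(** * Comparison of fibres *)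

Lemma points_center m n (M : 'M[int]_(m, n)) lo hi b c :
    unimodular M -> M *m (lo + hi) = c + c ->
  (#|` points M lo hi b| <= #|` points M lo hi c|)%N.
Proof.
move=> uM; have [N] := ubnP (\sum_j `|(hi j 0 - lo j 0)%R|)%N.
elim: N => // N IHN in lo hi c *; rewrite ltnS => leN Mc.
have [-> | [u0]] := fset_0Vmem (points M lo hi b); first by rewrite cardfs0.
rewrite mem_points => /andP[/in_boxP u0_in _].
have c_gt0 : (0 < #|` points M lo hi c|)%N.
  (* The centre of the box is a rational point over [c], to be rounded. *)
  pose y : 'cV[rat]_n := 2^-1 *: intmx (lo + hi).
  have [j | | u u_in Mu] := @unimodular_integral _ _ M lo hi c y uM.
  - rewrite !mxE rmorphD /=; have : lo j 0 <= hi j 0.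
      by have /andP[] := u0_in j; apply: le_trans.
    by rewrite -(ler_int rat); lra.
  - rewrite -scalemxAr -map_mxM Mc; apply/colP => i; rewrite !mxE rmorphD /=.
    by lra.
  rewrite cardfs_gt0; apply/fset0Pn; exists u.
  by rewrite mem_points Mu eqxx andbT; apply/in_boxP.
pose D := [fset (u - v)%R | u in box lo hi, v in box lo hi]%fset.
pose nb b d := #|` [fset u in points M lo hi b | (u - d)%R \in points M lo hi b]%fset|.
have subKl (u : 'cV[int]_n) : cancel (fun v => u - v) (fun v => u - v).
  exact: subKr.
have memD b' u v : u \in points M lo hi b' -> v \in points M lo hi b' -> u - v \in D.
  rewrite !mem_points -!mem_box => /andP[u_in _] /andP[v_in _].
  by apply/imfset2P; exists u => //; exists v.
have sq b' : (#|` points M lo hi b'| * #|` points M lo hi b'| = \sum_(d <- D) nb b' d)%N.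
  have := double_sum_reindex (fun _ => 1%N) subKl subKl (@memD b').
  under [RHS]eq_bigr => d _ do rewrite natn.
  rewrite -/(nb b') => <-.
  under eq_bigr do rewrite -card_fset_sum1.
  by rewrite big_const_seq count_predT iter_addn_0.
have nb0 b' : nb b' 0 = #|` points M lo hi b'|.
  rewrite /nb; congr #|` _|; apply/fsetP => u.
  by rewrite in_fset_sep subr0 andbb.
have D0 : 0 \in D.
  have [u u_in] := fset0Pn _ (etrans (esym (cardfs_gt0 _)) c_gt0).
  by rewrite -(subrr u); exact: (memD c).
have le_nb d : d \in D -> d != 0 -> (nb b d <= nb c d)%N.
  case/imfset2P=> v /=; rewrite mem_box => /in_boxP v_in [w].
  rewrite mem_box => /in_boxP w_in dE.
  move=> d_neq0; have [Md | Md_neq0] := eqVneq (M *m d) 0; last first.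
    (* Points of one fibre differ by kernel vectors, so no pair has difference [d]. *)
    rewrite {1}/nb (_ : [fset u in _ | _]%fset = fset0) ?cardfs0 //.
    apply/fsetP => u; rewrite in_fset_sep !mem_points inE mulmxBr.
    apply/negP => /andP[/andP[_ /eqP->] /andP[_]].
    by rewrite -subr_eq0 addrAC subrr add0r oppr_eq0 (negPf Md_neq0).
  rewrite /nb !points_sub //; apply: IHN; last first.
    rewrite (_ : _ + _ = lo + hi + d) ?mulmxDr ?Md ?addr0 -?mulmxDr //.
    by apply/colP => j; rewrite !mxE itv_sub_mid.
  have [j0 dj0] : exists j, d j 0 != 0.
    apply/existsP; apply: contraNT d_neq0 => /existsPn /= d0.
    by apply/eqP/colP => j; rewrite mxE; apply/eqP/negbNE/d0.
  (* As [d] is a difference of two points of the box, no width is below [|d j 0|], and each shrinks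
     by exactly that amount. *)
  have widthE j : (`|(minmx hi (hi + d) j 0 - maxmx lo (lo + d) j 0)%R| +
      `|(d j 0)%R| = `|(hi j 0 - lo j 0)%R|)%N.
    have := v_in j; have := w_in j; rewrite dE !mxE.
    move: (v j 0) (w j 0) (hi j 0) (lo j 0) => v' w' h l.
    lia.
  apply: leq_trans leN.
  rewrite (bigD1 j0) //= [X in (_ < X)%N](bigD1 j0) //= -addSn leq_add //.
    by rewrite -(widthE j0) -addn1 leq_add2l lt0n absz_eq0.
  by apply: leq_sum => j _; rewrite -widthE leq_addr.
pose D' := (D `\ (0 : 'cV[int]_n)%R)%fset.
have split_sq b' : (\sum_(d <- D) nb b' d =
    #|` points M lo hi b'| + \sum_(d <- D') nb b' d)%N.
  by rewrite (big_fsetD1 0) //= nb0.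
have le_rest : (\sum_(d <- D') nb b d <= \sum_(d <- D') nb c d)%N.
  rewrite !big_seq; apply: leq_sum => d; rewrite in_fsetD1 => /andP[d0 dD].
  exact: le_nb.
(* For the cardinalities B over [b] and C over [c] this gives B^2 - B <= C^2 - C, and C > 0 then
   excludes B > C. *)
have := sq b; have := sq c; rewrite !split_sq; nia.
Qed.

Lemma points_log_concave (R : numDomainType) m n (M : 'M[int]_(m, n)) lo hi
    b b' c (omega : 'cV[int]_n -> R) :
    unimodular M -> (forall u, 0 <= omega u) ->
    {morph omega : u v / u + v >-> u * v} -> b + b' = c + c ->
  (\sum_(u <- points M lo hi b) omega u) * (\sum_(u <- points M lo hi b') omega u)
    <= (\sum_(u <- points M lo hi c) omega u) ^+ 2.
Proof.
move=> uM omega_ge0 omegaD bb'.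
pose D := [fset (u + v)%R | u in box lo hi, v in box lo hi]%fset.
(* Multiplicativity makes the weight of a pair depend on its sum [w] only, so it suffices to compare
   the numbers of pairs for each [w]. *)
have sumE b1 b2 : (\sum_(u <- points M lo hi b1) omega u) *
    (\sum_(u <- points M lo hi b2) omega u) =
    \sum_(w <- D) omega w *+
      #|` [fset u in points M lo hi b1 | w - u \in points M lo hi b2]%fset|.
  rewrite -(@double_sum_reindex _ _ (fun u v => u + v) (fun u w => w - u) _
    (points M lo hi b2)).
  - rewrite mulr_suml; apply: eq_bigr => u _; rewrite mulr_sumr.
    by apply: eq_bigr => v _; rewrite omegaD.
  - by move=> u v /=; rewrite addrC addKr.
  - by move=> u v /=; rewrite addrC subrK.
  move=> u v; rewrite !mem_points -!mem_box => /andP[u_in _] /andP[v_in _].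
  by apply/imfset2P; exists u => //; exists v.
rewrite expr2.
rewrite (sumE b b').
rewrite (sumE c c).
apply: ler_sum => w _.
rewrite -[X in X <= _]mulr_natr -[X in _ <= X]mulr_natr.
apply: ler_wpM2l => //; rewrite ler_nat.
have [Mw | Mw_neq] := eqVneq (M *m w) (b + b').
  rewrite (points_rsub _ _ Mw) (points_rsub _ _ (etrans Mw bb')).
  apply: points_center => //.
  rewrite -bb' -Mw; congr (M *m _).
  by apply/colP => j; rewrite !mxE itv_rsub_mid.
(* A pair over [b] and [b'] with sum [w] would give [M *m w = b + b']. *)
rewrite (_ : [fset u in _ | _]%fset = fset0) ?cardfs0 //.
apply/fsetP => u; rewrite in_fset_sep !mem_points [RHS]inE mulmxBr.
apply/negP => /andP[/andP[_ /eqP->] /andP[_]].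
by rewrite subr_eq addrC (negPf Mw_neq).
Qed.

(** The convex combination of [u] and [v] with weights proportional to [p] and [q] is a rational
    point of the box over [c]; rounding it shows that there are no internal zeros. *)
Lemma points_gap m n (M : 'M[int]_(m, n)) lo hi b b' c (p q : nat) u v :
    unimodular M -> u \in points M lo hi b -> v \in points M lo hi b' ->
    (0 < p)%N -> (0 < q)%N -> p%:Z *: b + q%:Z *: b' = (p + q)%:Z *: c ->
  points M lo hi c != fset0.
Proof.
rewrite !mem_points => uM /andP[/in_boxP u_in /eqP Mu] /andP[/in_boxP v_in /eqP Mv].
move=> p_gt0 q_gt0 pqc.
have pq_gt0 : 0 < (p + q)%:R :> rat by rewrite ltr0n addn_gt0 p_gt0.
pose y : 'cV[rat]_n := (p + q)%:R^-1 *: intmx (p%:Z *: u + q%:Z *: v).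
have [j | | w w_in Mw] := @unimodular_integral _ _ M lo hi c y uM.
- have /andP[lo_u u_hi] := u_in j; have /andP[lo_v v_hi] := v_in j.
  rewrite !mxE mulrC ler_pdivlMr // ler_pdivrMr // -[(p + q)%:R]/(((p + q)%:Z)%:~R).
  rewrite -!intrM !ler_int !PoszD !mulrDr ![_ * p%:Z]mulrC ![_ * q%:Z]mulrC.
  by rewrite !lerD // ler_wpM2l.
- have pqE : intmx ((p + q)%:Z *: c) = (p + q)%:R *: intmx c.
    by apply/colP => i; rewrite !mxE intrM.
  rewrite -scalemxAr -map_mxM mulmxDr -!scalemxAr Mu Mv pqc pqE scalerA.
  by rewrite mulVf ?scale1r ?gt_eqF.
by apply/fset0Pn; exists w; rewrite mem_points Mw eqxx andbT; apply/in_boxP.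
Qed.

(** * Log-concavity of weighted slices *)

Lemma eq_log_concave (R : realType) (f g : int -> R) :
  f =1 g -> log_concave f -> log_concave g.
Proof.
move=> fg [f_ge0 f_gap f_lc].
by split=> [k|i j k|k]; rewrite -!fg; [exact: f_ge0 | exact: f_gap | exact: f_lc].
Qed.

Lemma points_col_mx s m n (a : 'M[int]_(s, n)) (B : 'M[int]_(m, n)) lo hi t b :
  points (col_mx a B) lo hi (col_mx t b) =
  [fset u in points B lo hi b | a *m u == t]%fset.
Proof.
apply/fsetP => u; rewrite in_fset_sep !mem_points mul_col_mx -andbA; congr (_ && _).
by apply/eqP/andP => [/eq_col_mx[-> ->] | [/eqP-> /eqP->]].
Qed.

(** Stacking [a] on [B] turns the slices into fibres whose right-hand sides lie on a line, so
    [points_gap] and [points_log_concave] apply. *)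
Lemma slice_log_concave (R : realType) m n (a : 'rV[int]_n) (B : 'M[int]_(m, n))
    lo hi b (omega : 'cV[int]_n -> R) :
    unimodular (col_mx a B) -> (forall u, 0 < omega u) ->
    {morph omega : u v / u + v >-> u * v} ->
  log_concave (fun t => \sum_(u <- points B lo hi b | (a *m u) 0 0 == t) omega u).
Proof.
move=> uM omega_gt0 omegaD.
pose c t : 'cV[int]_(1 + m) := col_mx t%:M b.
pose F t := \sum_(u <- points (col_mx a B) lo hi (c t)) omega u.
apply: (@eq_log_concave _ F) => [t | ].
  rewrite /F /c points_col_mx -big_fset_condE; apply: eq_bigl => u.
  by apply/eqP/eqP => [-> | <-]; [rewrite mxE eqxx | exact: mx11_scalar].
(* The weights are positive, so a sum vanishes only over an empty fibre. *)
have F_neq0 t : (F t != 0) = (points (col_mx a B) lo hi (c t) != fset0).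
  rewrite /F; have [-> | [u u_in]] := fset_0Vmem (points (col_mx a B) lo hi (c t)).
    by rewrite big_seq_fset0 !eqxx.
  rewrite (big_fsetD1 u) //= gt_eqF; last first.
    by rewrite ltr_pwDl // sumr_ge0 // => v _; apply: ltW.
  by apply/esym/fset0Pn; exists u.
split=> [t | i j k lt_ij lt_jk | t].
- by apply: sumr_ge0 => u _; apply: ltW.
- rewrite !F_neq0 => /fset0Pn[u u_in] /fset0Pn[v v_in].
  (* The weights come from (k - j) i + (j - i) k = (k - i) j. *)
  apply: (@points_gap _ _ _ _ _ _ _ _ `|k - j|%N `|j - i|%N _ _ uM u_in v_in).
  + by rewrite absz_gt0 subr_eq0 gt_eqF.
  + by rewrite absz_gt0 subr_eq0 gt_eqF.
  rewrite PoszD !gez0_abs ?subr_ge0 ?ltW // /c !scale_col_mx add_col_mx.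
  congr col_mx; last by rewrite -scalerDl.
  by rewrite !scale_scalar_mx -raddfD /=; congr _%:M; lia.
- apply: points_log_concave => //; first by move=> u; apply: ltW.
  rewrite !add_col_mx -!raddfD /=; congr (col_mx _%:M _); lia.
Qed.

(** * Generating functions of fibres *)

Definition lattice_sum (R : realType) r n (A : 'M[int]_(r, n))
    (S : {fset 'cV[int]_n}) : laurent R r :=
  \sum_(u <- S) lmonom R (A *m u)^T.

(** Distinct indices may give the same monomial; additivity of [F] in the coefficient makes such
    collisions harmless. *)
Lemma lmonom_linear (R : realType) r (V : zmodType) (F : 'rV[int]_r -> R -> V)
    (I : Type) (s : seq I) (h : I -> 'rV[int]_r) :
    (forall a, {morph F a : x y / x + y}) ->
  let p : laurent R r := \sum_(i <- s) lmonom R (h i) in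
  \sum_(a <- msupp p) F a p@_a = \sum_(i <- s) F (h i) 1.
Proof.
move=> FD /=; have F0 a : F a 0 = 0.
  by apply: (addrI (F a 0)); rewrite -FD !addr0.
elim: s => [|i s IHs]; first by rewrite !big_nil msupp0 big_seq_fset0.
rewrite !big_cons -IHs; set p := \sum_(_ <- s) _.
set d := (msupp (lmonom R (h i)) `|` msupp p)%fset.
rewrite (@lsum_ext _ _ _ _ _ d) ?msuppD_le //.
rewrite (@lsum_ext _ _ _ _ p d) ?fsubsetUr //.
under eq_bigr do rewrite mcoeffD FD.
rewrite big_split /= -lsum_ext ?fsubsetUl //; congr (_ + _).
by rewrite (lsum_ext _ (msuppU_le (k := h i))) // big_seq_fset1 mcoeffUU.
Qed.

Section LatticeSum.
Variables (R : realType) (r n : nat) (A : 'M[int]_(r, n)) (S : {fset 'cV[int]_n}).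

Lemma mcoeff_lattice_sum a :
  (lattice_sum R A S)@_a = \sum_(u <- S | (A *m u)^T == a) 1.
Proof.
rewrite /lattice_sum raddf_sum [RHS]big_mkcond /=; apply: eq_bigr => u _.
by rewrite /lmonom mcoeffU; case: eqP.
Qed.

Lemma leval_but_lattice_sum (i : 'I_r) (x : 'I_r -> R) k :
  (leval_but i x (lattice_sum R A S))@_(const_mx k) =
  \sum_(u <- S | (row i A *m u) 0 0 == k) \prod_(j < r | j != i) x j ^ (A *m u) j 0.
Proof.
rewrite /leval_but /lattice_sum.
rewrite (lmonom_linear (F := fun a y =>
  << y * (\prod_(j < r | j != i) x j ^ a 0 j) *g const_mx (a 0 i) >> : laurent R 1)).
  rewrite raddf_sum [RHS]big_mkcond /=; apply: eq_bigr => u _.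
  rewrite mcoeffU mul1r.
  have -> : (const_mx ((A *m u)^T 0 i) == const_mx k :> 'rV_1) =
      ((row i A *m u) 0 0 == k).
    rewrite -row_mul; apply/eqP/eqP => [/matrixP/(_ 0 0) | <-]; first by rewrite !mxE.
    by apply/matrixP => a b; rewrite !mxE.
  by case: eqP => _; rewrite ?mulr0n // mulr1n; apply: eq_bigr => j _; rewrite mxE.
by move=> a y z; rewrite mulrDl monalgUD.
Qed.

End LatticeSum.

Lemma lcoef_lattice_sum (R : realType) r n (A : 'M[int]_(r.+1, n)) S i alpha :
  lcoef i alpha (lattice_sum R A S) =
  lattice_sum R (row' i A) [fset u in S | row i A *m u == alpha%:M]%fset.
Proof.
rewrite /lcoef /lattice_sum big_mkcond /=.
rewrite (lmonom_linear (F := fun a y =>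
  if a 0 i == alpha then << y *g col' i a >> : laurent R r else 0)); last first.
  by move=> a y z /=; case: ifP => _; rewrite ?addr0 ?monalgUD.
rewrite -[RHS]big_fset_condE [RHS]big_mkcond; apply: eq_bigr => u _.
have -> : (row i A *m u == alpha%:M) = ((A *m u)^T 0 i == alpha).
  rewrite -row_mul; apply/eqP/eqP => [/matrixP/(_ 0 0) | <-]; first by rewrite !mxE.
  by apply/matrixP => a b; rewrite !ord1 !mxE eqxx.
case: ifP => // _; rewrite /lmonom -tr_row'; congr << _ *g _^T >>.
by apply/matrixP => a b; rewrite !mxE; apply: eq_bigr => j _; rewrite !mxE.
Qed.

(** The constraint matrix [B] is general because extracting a coefficient of the [i]-th variable
    moves row [i] from [A] to [B], which leaves the rows of the stacked matrix the same; this drives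
    the induction on [r]. *)
Lemma lattice_sum_VLC (R : realType) r s n (A : 'M[int]_(r.+1, n))
    (B : 'M[int]_(s, n)) lo hi b : unimodular (col_mx A B) ->
  VLC_succ (lattice_sum R A (points B lo hi b)).
Proof.
elim: r => [|r IHr] in s A B b *; rewrite /= => uAB.
  apply: (@eq_log_concave _ (fun t =>
    \sum_(u <- points B lo hi b | (A *m u) 0 0 == t) 1)) => [t | ].
    rewrite mcoeff_lattice_sum; apply: eq_bigl => u.
    apply/eqP/eqP => [<- | /matrixP/(_ 0 0)]; last by rewrite !mxE.
    by apply/matrixP => i j; rewrite !ord1 !mxE.
  apply: slice_log_concave => //; first by move=> u v; rewrite mulr1.
have uiB i : unimodular (col_mx (row i A) B).
  apply: (unimodular_rows uAB) => j; rewrite -[j]splitK; case: split => {}j /=.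
    by exists (lshift _ i); rewrite !rowKu; apply/rowP => k; rewrite !mxE.
  by exists (rshift _ j); rewrite !rowKd.
split=> [a | i x x_gt0 | i alpha].
- by rewrite mcoeff_lattice_sum sumr_ge0.
- rewrite /VLC1; apply: (@eq_log_concave _ (fun t =>
    \sum_(u <- points B lo hi b | (row i A *m u) 0 0 == t)
      \prod_(j < r.+2 | j != i) x j ^ (A *m u) j 0)) => [t | ].
    by rewrite leval_but_lattice_sum.
  (* The weight of [u] is the evaluated monomial in the other variables, multiplicative because its
     exponents are additive in [u]. *)
  apply: slice_log_concave (uiB i) _ _ => [u | u v].
    by apply: prodr_gt0 => j ji; apply/exprz_gt0/x_gt0.
  rewrite -big_split; apply: eq_bigr => j ji /=.
  by rewrite mulmxDr mxE expfzDr // gt_eqF // x_gt0.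
rewrite lcoef_lattice_sum -points_col_mx; apply: IHr.
apply: (unimodular_rows uAB) => j; rewrite -[j]splitK; case: split => {}j /=.
  exists (lshift _ (lift i j)); rewrite !rowKu; apply/rowP => k; rewrite !mxE //.
rewrite rowKd -[j]splitK; case: split => {}j /=.
  by exists (lshift _ i); rewrite !rowKu; apply/rowP => k; rewrite !mxE.
by exists (rshift _ j); rewrite !rowKd.
Qed.

(** * Expansion of the product *)

Lemma lmonom_prod (R : realType) r (I : Type) (s : seq I) (h : I -> 'rV[int]_r) :
  \prod_(i <- s) lmonom R (h i) = lmonom R (\sum_(i <- s) h i).
Proof.
have lmonomD : {morph (@lmonom R r) : a b / a + b >-> a * b}.
  by move=> a b; rewrite /lmonom [RHS]lmulUU mulr1.
by rewrite (big_morph _ lmonomD (erefl _)).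
Qed.

(** The right-hand side has the shape produced by distributing a product over sums, where all
    factors share one index type; [N] bounds every [k j]. *)
Lemma box0_sum (V : nmodType) n (k : 'I_n -> nat) (G : 'cV[int]_n -> V) :
  let N := (\sum_j k j)%N in
  \sum_(u <- box 0 (\col_j (k j)%:Z)) G u =
  \sum_(f in family (fun j => [pred l : 'I_N.+1 | (l < (k j).+1)%N]))
    G (\col_j (f j)%:Z).
Proof.
move=> N; pose Q := family (fun j => [pred l : 'I_N.+1 | (l < (k j).+1)%N]).
pose g (f : {ffun 'I_n -> 'I_N.+1}) : 'cV[int]_n := \col_j (f j)%:Z.
have g_inj : {in Q &, injective g}.
  move=> f f' _ _ /colP eq_ff'; apply/ffunP => j; apply/val_inj.
  by have := eq_ff' j; rewrite !mxE => -[].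
transitivity (\sum_(u <- [fset g f | f in Q]%fset) G u).
  apply: eq_fbigl => u; rewrite mem_box.
  apply/in_boxP/imfsetP => /= [u_in | [f /familyP Qf ->] j]; last first.
    by have := Qf j; rewrite !mxE inE ltnS lez_nat.
  have u_le j : u j 0 = Posz `|(u j 0)%R|%N /\ (`|(u j 0)%R| <= k j)%N.
    have := u_in j; rewrite !mxE; case: (u j 0) => // l.
  exists [ffun j => inord `|(u j 0)%R|%N].
    apply/familyP => j; rewrite inE ffunE inordK; first by have [] := u_le j.
    by rewrite ltnS (leq_trans (u_le j).2) // /N (bigD1 j) //= leq_addr.
  apply/colP => j; rewrite mxE ffunE inordK; first by have [] := u_le j.
  by rewrite ltnS (leq_trans (u_le j).2) // /N (bigD1 j) //= leq_addr.
by rewrite big_imfset //= big_enum.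
Qed.

(** Choosing a term [u j] in each factor yields the monomial with exponent [M *m u]. The constraint
    matrix has no rows, so its fibre is the whole box. *)
Lemma Ppoly_lattice_sum (R : realType) m n (M : 'M[int]_(m, n)) (k : 'I_n -> nat) :
  Ppoly R M k =
  lattice_sum R M (points (0 : 'M_(0, n)) 0 (\col_j (k j)%:Z) 0).
Proof.
have -> : points (0 : 'M_(0, n)) 0 (\col_j (k j)%:Z) 0 = box 0 (\col_j (k j)%:Z).
  by apply/fsetP => u; rewrite mem_points mem_box mul0mx eqxx andbT.
rewrite /lattice_sum box0_sum /Ppoly.
set N := (\sum_j k j)%N.
under eq_bigr => j _.
  rewrite (big_ord_widen N.+1 (fun l => lmonom R (l%:Z *: (col j M)^T))); last first.
    by rewrite ltnS /N (bigD1 j) //= leq_addr.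
  over.
rewrite bigA_distr_big_dep; apply: eq_bigr => f _; rewrite lmonom_prod.
congr lmonom; apply/rowP => i; rewrite summxE !mxE; apply: eq_bigr => j _.
by rewrite !mxE mulrC.
Qed.

Theorem corollary3p10 (R : realType) (m n : nat) (hm : (0 < m)%N)
    (M : 'M[int]_(m, n)) (hM : totally_unimodular M) (k : 'I_n -> nat) :
  VLC (Ppoly R M k).
Proof.
case: m hm M hM => // m _ M /totally_unimodularP uM.
rewrite Ppoly_lattice_sum /VLC; apply: lattice_sum_VLC.
apply: (unimodular_rows uM) => j; rewrite -[j]splitK; case: split => [{}j|[]//].
by exists j; rewrite rowKu.
Qed.
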